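(* Let $\overline{A_1A_2A_3}$ be any triangle in the plane over a field of characteristic not two, with blue, red and green circumcenters $C_b,C_r,C_g$ and blue, red and green nine-point centers $N_b,N_r,N_g$. Then each coloured nine-point center is the midpoint of the two circumcenters of the other two colours: $N_b$ is the midpoint of $C_r$ and $C_g$, $N_r$ is the midpoint of $C_b$ and $C_g$, and $N_g$ is the midpoint of $C_b$ and $C_r$.
   Context: Work over a fixed field not of characteristic two. A point is an ordered pair $[x,y]$ of field elements. A line is a proportion $\langle a:b:c\rangle$ with $a,b$ not both zero; the point $[x,y]$ lies on it precisely when $ax+by+c=0$. Lines $\langle a_1:b_1:c_1\rangle$ and $\langle a_2:b_2:c_2\rangle$ are blue perpendicular when $a_1a_2+b_1b_2=0$, red perpendicular when $a_1a_2-b_1b_2=0$, and green perpendicular when $a_1b_2+b_1a_2=0$. A triangle $\overline{A_1A_2A_3}$ is a set of three distinct non-collinear points. For each colour, the perpendicular bisector of that colour of a side $\overline{A_iA_j}$ is the unique line through the midpoint of $A_i$ and $A_j$ perpendicular to the line $A_iA_j$ in that colour, and the circumcenter of that colour is the common point of the three perpendicular bisectors of that colour (it always exists and is unique). The nine-point center of a given colour of $\overline{A_1A_2A_3}$ is the circumcenter of that colour of the triangle $\overline{M_1M_2M_3}$, where $M_1,M_2,M_3$ are the midpoints of the sides $\overline{A_2A_3},\overline{A_1A_3},\overline{A_1A_2}$. *)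

(* Defs.v *)
From mathcomp Require Import all_boot all_algebra.
From mathcomp Require Import ring.

Set Implicit Arguments.
Unset Strict Implicit.
Unset Printing Implicit Defensive.

Import GRing.Theory.
Local Open Scope ring_scope.
Local Open Scope quotient_scope.

Variant colour := Blue | Red | Green.

Section Chromogeometry.

Variable F : fieldType.

Definition point : Type := F * F.

(* A triple ((a, b), c) representing the line <a : b : c>. *)
Definition coefs := {u : F * F * F | (u.1.1 != 0) || (u.1.2 != 0)}.

Definition coefa (u : coefs) : F := (val u).1.1.
Definition coefb (u : coefs) : F := (val u).1.2.
Definition coefc (u : coefs) : F := (val u).2.

(* Decidable form of "v is a nonzero multiple of u"; see proportionalP. *)
Definition proportional (u v : coefs) : bool :=
  [&& coefa u * coefb v == coefa v * coefb u,
      coefa u * coefc v == coefa v * coefc u &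
      coefb u * coefc v == coefb v * coefc u].

Lemma proportionalP (u v : coefs) :
  reflect (exists2 k : F, k != 0 &
             [/\ coefa v = k * coefa u, coefb v = k * coefb u
               & coefc v = k * coefc u])
          (proportional u v).
Proof.
apply: (iffP and3P) => [[/eqP hab /eqP hac /eqP hbc] | [k _ [-> -> ->]]];
  last by split; apply/eqP; ring.
case/orP: (valP u) => u0; [exists (coefa v / coefa u) | exists (coefb v / coefb u)].
- rewrite mulf_neq0 ?invr_eq0 //; apply/eqP => v0.
  have := valP v; rewrite -/(coefa v) -/(coefb v) v0 eqxx /= => /negP[].
  by move/eqP: hab; rewrite v0 mul0r mulf_eq0 (negPf u0).
- split; apply: (mulfI u0); rewrite -/(coefa u).
  + by field.
  + by rewrite hab; field.
  + by rewrite hac; field.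
- rewrite mulf_neq0 ?invr_eq0 //; apply/eqP => v0.
  have := valP v; rewrite -/(coefa v) -/(coefb v) v0 eqxx orbF => /negP[].
  by move/eqP: hab; rewrite v0 mulr0 eq_sym mulf_eq0 (negPf u0) orbF.
- split; apply: (mulfI u0); rewrite -/(coefb u).
  + by rewrite mulrC -hab; field.
  + by field.
  + by rewrite hbc; field.
Qed.

Lemma proportional_refl : reflexive proportional.
Proof. by move=> u; rewrite /proportional !eqxx. Qed.

Lemma proportional_sym : symmetric proportional.
Proof.
by move=> u v; rewrite /proportional; congr [&& _, _ & _]; rewrite eq_sym.
Qed.

Lemma proportional_trans : transitive proportional.
Proof.
move=> v u w /proportionalP[k k0 [ha hb hc]] /proportionalP[l l0 [ea eb ec]].
apply/proportionalP; exists (l * k); first by rewrite mulf_neq0.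
by rewrite ea eb ec ha hb hc !mulrA.
Qed.

Canonical proportional_equiv :=
  EquivRel proportional proportional_refl proportional_sym proportional_trans.

Definition line := {eq_quot proportional}.

Definition coefs_on (P : point) (u : coefs) : bool :=
  coefa u * P.1 + coefb u * P.2 + coefc u == 0.

Definition coefs_perp (k : colour) (u v : coefs) : bool :=
  match k with
  | Blue => coefa u * coefa v + coefb u * coefb v == 0
  | Red => coefa u * coefa v - coefb u * coefb v == 0
  | Green => coefa u * coefb v + coefb u * coefa v == 0
  end.

(* Independent of the representatives: see on_line_pi and perp_pi. *)
Definition on_line (P : point) (l : line) : bool := coefs_on P (repr l).

Definition perp (k : colour) (l m : line) : bool :=
  coefs_perp k (repr l) (repr m).

Lemma repr_piP (u : coefs) : proportional u (repr (\pi_line u)).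
Proof. by apply/(@eqquotP _ proportional_equiv line); rewrite reprK. Qed.

Lemma on_line_pi (P : point) (u : coefs) : on_line P (\pi u) = coefs_on P u.
Proof.
rewrite /on_line /coefs_on; have /proportionalP[k k0 [-> -> ->]] := repr_piP u.
by rewrite -!mulrA -!mulrDr mulf_eq0 (negPf k0).
Qed.

Lemma perp_pi (k : colour) (u v : coefs) :
  perp k (\pi u) (\pi v) = coefs_perp k u v.
Proof.
rewrite /perp /coefs_perp.
have /proportionalP[r r0 [-> -> _]] := repr_piP u.
have /proportionalP[s s0 [-> -> _]] := repr_piP v.
have rs0 : r * s != 0 by rewrite mulf_neq0.
by case: k; rewrite -[X in _ = (X == 0)](mulKf rs0) mulf_eq0 invr_eq0 (negPf rs0) /=;
   congr (_ == 0); ring.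
Qed.

Definition collinear (P Q R : point) : Prop :=
  exists l : line, [/\ on_line P l, on_line Q l & on_line R l].

Definition is_triangle (A1 A2 A3 : point) : Prop :=
  [/\ A1 != A2, A1 != A3, A2 != A3 & ~ collinear A1 A2 A3].

Definition midpoint (P Q : point) : point :=
  ((P.1 + Q.1) / 2, (P.2 + Q.2) / 2).

(* For P != Q the line m through P and Q is unique, and so is l;
   see line_through_unique and perp_bisector_unique. *)
Definition perp_bisector (k : colour) (P Q : point) (l : line) : Prop :=
  on_line (midpoint P Q) l /\
  exists m : line, [/\ on_line P m, on_line Q m & perp k l m].

(* For a triangle there is exactly one such C; see circumcenter_unique. *)
Definition circumcenter (k : colour) (A1 A2 A3 C : point) : Prop :=
  exists l1 l2 l3 : line,
    [/\ perp_bisector k A2 A3 l1, perp_bisector k A1 A3 l2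
      & perp_bisector k A1 A2 l3] /\
    [/\ on_line C l1, on_line C l2 & on_line C l3].

Definition nine_point_center (k : colour) (A1 A2 A3 N : point) : Prop :=
  circumcenter k (midpoint A2 A3) (midpoint A1 A3) (midpoint A1 A2) N.

Lemma eq_line (u v : coefs) : proportional u v -> \pi_line u = \pi_line v.
Proof. by move/(@eqquotP _ proportional_equiv line). Qed.

Lemma point_neq (P Q : point) :
  P != Q -> (P.2 - Q.2 != 0) || (Q.1 - P.1 != 0).
Proof.
case: P Q => [x y] [x' y'] /=; rewrite !subr_eq0 xpair_eqE negb_and orbC.
by rewrite (eq_sym x' x).
Qed.

Definition join_coefs (P Q : point) (h : P != Q) : coefs :=
  exist _ (P.2 - Q.2, Q.1 - P.1, P.1 * Q.2 - Q.1 * P.2) (point_neq h).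

Lemma join_coefs_on (P Q : point) (h : P != Q) :
  on_line P (\pi_line (join_coefs h)) /\ on_line Q (\pi_line (join_coefs h)).
Proof.
by rewrite !on_line_pi /coefs_on /coefa /coefb /coefc /=; split;
   apply/eqP; ring.
Qed.

Lemma proportional_on (P : point) (u v : coefs) :
  coefa u * coefb v = coefa v * coefb u -> coefs_on P u -> coefs_on P v ->
  proportional u v.
Proof.
rewrite /coefs_on => e /eqP hu /eqP hv.
have cu : coefc u = - (coefa u * P.1 + coefb u * P.2).
  by apply/eqP; rewrite -addr_eq0 addrC hu.
have cv : coefc v = - (coefa v * P.1 + coefb v * P.2).
  by apply/eqP; rewrite -addr_eq0 addrC hv.
apply/and3P; split; apply/eqP; rewrite ?cu ?cv //.
- transitivity (- (coefa u * coefa v * P.1 + (coefa u * coefb v) * P.2)); first ring.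
  by rewrite e; ring.
- transitivity (- (coefb u * coefb v * P.2 + (coefa v * coefb u) * P.1)); first ring.
  by rewrite -e; ring.
Qed.

Lemma line_through_unique (P Q : point) :
  P != Q -> exists! m : line, on_line P m /\ on_line Q m.
Proof.
move=> h; exists (\pi_line (join_coefs h)); split; first exact: join_coefs_on.
elim/quotP => v _; rewrite !on_line_pi => -[hP hQ].
apply/eq_line/(@proportional_on P) => //; last first.
  by rewrite -on_line_pi; case: (join_coefs_on h).
move: hP hQ; rewrite /coefs_on /coefa /coefb /coefc /=.
case: (sval v) => -[a b] c /= /eqP hP /eqP hQ.
apply/eqP; rewrite -subr_eq0; apply/eqP.
by rewrite -[RHS]subr0 -{1}hP -hQ; ring.
Qed.

(* The solution, up to scaling, of perpendicularity to the normal
   (P.2 - Q.2, Q.1 - P.1) of the line joining P and Q. *)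
Definition bis_normal (k : colour) (P Q : point) : F * F :=
  match k with
  | Blue => (Q.1 - P.1, Q.2 - P.2)
  | Red => (Q.1 - P.1, P.2 - Q.2)
  | Green => (Q.2 - P.2, Q.1 - P.1)
  end.

Lemma bis_normal_neq (k : colour) (P Q : point) (h : P != Q) :
  ((bis_normal k P Q).1 != 0) || ((bis_normal k P Q).2 != 0).
Proof.
have := point_neq h; have e : P.2 - Q.2 = - (Q.2 - P.2) by rewrite opprB.
by case: k => /=; rewrite ?e oppr_eq0 1?orbC.
Qed.

Definition bis_coefs (k : colour) (P Q : point) (h : P != Q) : coefs :=
  exist _ (bis_normal k P Q,
           - ((bis_normal k P Q).1 * (midpoint P Q).1
              + (bis_normal k P Q).2 * (midpoint P Q).2)) (bis_normal_neq k h).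

Lemma perp_bisectorP (k : colour) (P Q : point) (h : P != Q) (l : line) :
  perp_bisector k P Q l <-> l = \pi_line (bis_coefs k h).
Proof.
have bM : coefs_on (midpoint P Q) (bis_coefs k h).
  by rewrite /coefs_on /coefa /coefb /coefc /= subrr.
split=> [[]|->]; last first.
  rewrite /perp_bisector on_line_pi; split=> //; exists (\pi_line (join_coefs h)).
  have [-> ->] := join_coefs_on h; split=> //; rewrite perp_pi.
  by case: k {bM}; rewrite /= /coefa /coefb /=; apply/eqP; ring.
elim/quotP: l => u _; rewrite on_line_pi => uM [m [mP mQ]].
have [m0 [_ m0P]] := line_through_unique h.
have -> : m = \pi_line (join_coefs h).
  by rewrite -(m0P m) // -(m0P _ (join_coefs_on h)).
rewrite perp_pi => up; apply/eq_line/(proportional_on _ uM bM).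
apply/eqP; rewrite -subr_eq0; apply/eqP.
by case: k up {bM} => /=; rewrite /coefa /coefb /=;
   case: (sval u) => -[a b] c /= /eqP e;
   [rewrite -[RHS]oppr0 -[in RHS]e | rewrite -[RHS]e ..]; ring.
Qed.

Lemma perp_bisector_unique (k : colour) (P Q : point) :
  P != Q -> exists! l : line, perp_bisector k P Q l.
Proof.
move=> h; exists (\pi_line (bis_coefs k h)); split; first exact/perp_bisectorP.
by move=> l /(perp_bisectorP k h).
Qed.

Lemma noncollinear_det (A1 A2 A3 : point) :
  is_triangle A1 A2 A3 ->
  (A2.1 - A1.1) * (A3.2 - A1.2) - (A3.1 - A1.1) * (A2.2 - A1.2) != 0.
Proof.
case=> h _ _ nc; apply/eqP => e; apply: nc; exists (\pi_line (join_coefs h)).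
have [-> ->] := join_coefs_on h; split=> //.
rewrite on_line_pi /coefs_on /coefa /coefb /coefc /=; apply/eqP.
by rewrite -e; ring.
Qed.

Lemma cramer2 (u v : coefs) :
  coefa u * coefb v - coefa v * coefb u != 0 ->
  exists! C : point, coefs_on C u && coefs_on C v.
Proof.
rewrite /coefs_on; set a := coefa u; set b := coefb u; set c := coefc u.
set a' := coefa v; set b' := coefb v; set c' := coefc v => D0.
exists ((b * c' - b' * c) / (a * b' - a' * b),
        (a' * c - a * c') / (a * b' - a' * b)); split.
  by apply/andP; split; apply/eqP => /=; field.
move=> [x y] /= /andP[/eqP e /eqP e'].
congr pair; apply: (mulIf D0); rewrite divfK //; apply/eqP;
  rewrite -subr_eq0; apply/eqP.
- transitivity (b * (a' * x + b' * y + c') - b' * (a * x + b * y + c)); first ring.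
  by rewrite e e'; ring.
- transitivity (a' * (a * x + b * y + c) - a * (a' * x + b' * y + c')); first ring.
  by rewrite e e'; ring.
Qed.

Lemma circumcenter_unique (k : colour) (A1 A2 A3 : point) :
  is_triangle A1 A2 A3 -> exists! C : point, circumcenter k A1 A2 A3 C.
Proof.
move=> T; have D0 := noncollinear_det T; case: T => h12 h13 h23 _.
have cP C : circumcenter k A1 A2 A3 C <->
    coefs_on C (bis_coefs k h13) && coefs_on C (bis_coefs k h12).
  split=> [[l1 [l2 [l3 [[_ h2 h3] [_ C2 C3]]]]]|/andP[C2 C3]].
    move/(perp_bisectorP k h13): h2 C2 => ->; rewrite on_line_pi => ->.
    by move/(perp_bisectorP k h12): h3 C3 => ->; rewrite on_line_pi.
  exists (\pi_line (bis_coefs k h23)), (\pi_line (bis_coefs k h13)), (\pi_line (bis_coefs k h12)).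
  split; first by split; apply/perp_bisectorP.
  rewrite !on_line_pi C2 C3; split=> //.
  move: C2 C3; rewrite /coefs_on /coefa /coefb /coefc.
  by case: k => /= /eqP C2 /eqP C3; apply/eqP; rewrite -[RHS]subr0
     -[X in _ = X - _]C2 -[X in _ = _ - X]C3; ring.
have [|C [/cP hC C_uniq]] := @cramer2 (bis_coefs k h13) (bis_coefs k h12).
  have [s s0 ->] : exists2 s : F, s != 0 &
      coefa (bis_coefs k h13) * coefb (bis_coefs k h12)
      - coefa (bis_coefs k h12) * coefb (bis_coefs k h13)
      = s * ((A2.1 - A1.1) * (A3.2 - A1.2) - (A3.1 - A1.1) * (A2.2 - A1.2)).
    exists (if k is Blue then -1 else 1); last first.
      by case: (k); rewrite /coefa /coefb /=; ring.
    by case: (k); rewrite ?oppr_eq0 oner_neq0.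
  exact: mulf_neq0.
by exists C; split=> // C' /cP; apply: C_uniq.
Qed.

Lemma medial_triangle (A1 A2 A3 : point) :
  2%N \notin [pchar F] -> is_triangle A1 A2 A3 ->
  is_triangle (midpoint A2 A3) (midpoint A1 A3) (midpoint A1 A2).
Proof.
rewrite inE /= => two0 T; have D0 := noncollinear_det T.
have col (P Q R : point) : P = Q \/ P = R \/ Q = R \/ collinear P Q R ->
    (Q.1 - P.1) * (R.2 - P.2) - (R.1 - P.1) * (Q.2 - P.2) = 0.
  case: (eqVneq P Q) => [->|n]; first by move=> _; rewrite !subrr; ring.
  case: (eqVneq P R) => [->|n']; first by move=> _; rewrite !subrr; ring.
  case=> [e|]; first by rewrite e eqxx in n.
  case=> [e|]; first by rewrite e eqxx in n'.
  case=> [->|[l [lP lQ lR]]]; first ring.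
  have [m [_ mu]] := line_through_unique n.
  have := lR; rewrite -(mu l) // (mu _ (join_coefs_on n)) on_line_pi.
  rewrite /coefs_on /coefa /coefb /coefc /= => /eqP e.
  by rewrite -[RHS]e; ring.
have M0 : ~ (let P := midpoint A2 A3 in let Q := midpoint A1 A3 in
    let R := midpoint A1 A2 in
    (Q.1 - P.1) * (R.2 - P.2) - (R.1 - P.1) * (Q.2 - P.2) = 0).
  move=> /= e; move/negP: D0; apply.
  have -> : (A2.1 - A1.1) * (A3.2 - A1.2) - (A3.1 - A1.1) * (A2.2 - A1.2)
    = 2 ^+ 2 * 0 :> F by rewrite -e; field.
  by rewrite mulr0.
by split; try apply/eqP => e; try move=> e; apply: M0; apply: col; auto.
Qed.

End Chromogeometry.

(* Main.v *)
Require Import Defs.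
From mathcomp Require Import all_boot all_algebra.
From mathcomp Require Import ring.
Import GRing.Theory.
Local Open Scope ring_scope.

(** Each colour comes from a quadratic form [q] whose Gram matrix [G] is an
    involution.  The circumcenter [C] solves
    [(Aj - Ai) . G C = (q Aj - q Ai) / 2], so Cramer's rule gives [G C], hence
    [C], as an explicit rational function of the vertices.  The same formula
    applied to the medial triangle yields the nine-point centers. *)

Definition quadrance {F : fieldType} (k : colour) (P : point F) : F :=
  match k with
  | Blue => P.1 ^+ 2 + P.2 ^+ 2
  | Red => P.1 ^+ 2 - P.2 ^+ 2
  | Green => 2 * P.1 * P.2
  end.

Definition gram {F : fieldType} (k : colour) (P : point F) : point F :=
  match k with
  | Blue => P
  | Red => (P.1, - P.2)
  | Green => (P.2, P.1)
  end.

Definition tri_det {F : fieldType} (A1 A2 A3 : point F) : F :=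
  (A2.1 - A1.1) * (A3.2 - A1.2) - (A3.1 - A1.1) * (A2.2 - A1.2).

(** The Cramer numerators for the rows [A2 - A1] and [A3 - A1], regrouped by the values [q Ai]; the
    outer [gram k] recovers [C] from [G C]. *)
Definition circumcenter_point {F : fieldType} (k : colour)
    (A1 A2 A3 : point F) : point F :=
  let q := quadrance k in
  let d := 2 * tri_det A1 A2 A3 in
  gram k
    ((q A1 * (A2.2 - A3.2) + q A2 * (A3.2 - A1.2) + q A3 * (A1.2 - A2.2)) / d,
     (q A1 * (A3.1 - A2.1) + q A2 * (A1.1 - A3.1) + q A3 * (A2.1 - A1.1)) / d).

Section Circumcenters.

Context {F : fieldType}.
Hypothesis char_neq2 : 2%N \notin [pchar F].

Let two_neq0 : 2 != 0 :> F.
Proof. by move: char_neq2; rewrite inE. Qed.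

Let four_neq0 : 4 != 0 :> F.
Proof. by rewrite (natrM F 2 2) mulf_neq0. Qed.

Lemma gramK (k : colour) : cancel (@gram F k) (@gram F k).
Proof. by case: k => -[u v]; rewrite /= ?opprK. Qed.

Lemma circumcenter_pointP {k : colour} {A1 A2 A3 C : point F} :
  is_triangle A1 A2 A3 -> circumcenter k A1 A2 A3 C ->
  C = circumcenter_point k A1 A2 A3.
Proof.
move=> T [l1 [l2 [l3 [[_ b2 b3] [_ C2 C3]]]]].
have D0 : tri_det A1 A2 A3 != 0 := noncollinear_det T.
have d0 : 2 * tri_det A1 A2 A3 != 0 by rewrite mulf_neq0.
case: T => h12 h13 _ _.
move/(perp_bisectorP k h13): b2 C2 => ->; rewrite on_line_pi => /eqP e13.
move/(perp_bisectorP k h12): b3 C3 => ->; rewrite on_line_pi => /eqP e12.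
(* Both bisector equations vanish at [C], so writing [t * (2 * tri_det A1 A2 A3) - n] as a
   combination of them certifies the value of [t]. *)
have combine (a b t n : F) :
    t * (2 * tri_det A1 A2 A3) - n =
      a * (coefa (bis_coefs k h12) * C.1 + coefb (bis_coefs k h12) * C.2
           + coefc (bis_coefs k h12))
      + b * (coefa (bis_coefs k h13) * C.1 + coefb (bis_coefs k h13) * C.2
           + coefc (bis_coefs k h13)) ->
    t = n / (2 * tri_det A1 A2 A3).
  rewrite e12 e13 !mulr0 addr0 => /eqP; rewrite subr_eq0 => /eqP <-.
  by rewrite mulfK.
apply: (can_inj (gramK k)); rewrite gramK [LHS]surjective_pairing.
congr pair.
(* The multipliers here and below are twice the rows of the adjugate of the matrix with rows
   [A2 - A1] and [A3 - A1]. Comparing [G C] rather than [C] makes them the same for every colour. *)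
- apply: (combine (2 * (A3.2 - A1.2)) (2 * (A1.2 - A2.2))).
  by case: k {e12 e13 combine}; rewrite /tri_det /coefa /coefb /coefc /=; field.
- apply: (combine (2 * (A1.1 - A3.1)) (2 * (A2.1 - A1.1))).
  by case: k {e12 e13 combine}; rewrite /tri_det /coefa /coefb /coefc /=; field.
Qed.

(** The homothety of ratio -1/2 about the centroid multiplies areas by 1/4. This puts all six
    centers over one determinant. *)
Lemma tri_det_medial (A1 A2 A3 : point F) :
  tri_det (midpoint A2 A3) (midpoint A1 A3) (midpoint A1 A2)
  = tri_det A1 A2 A3 / 4.
Proof. by rewrite /tri_det /midpoint /=; field; rewrite four_neq0. Qed.

End Circumcenters.

Theorem theorem17 (F : fieldType) (char_neq2 : 2%N \notin [pchar F])
    (A1 A2 A3 : point F) (triA : is_triangle A1 A2 A3)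
    (Cb Cr Cg Nb Nr Ng : point F)
    (hCb : circumcenter Blue A1 A2 A3 Cb)
    (hCr : circumcenter Red A1 A2 A3 Cr)
    (hCg : circumcenter Green A1 A2 A3 Cg)
    (hNb : nine_point_center Blue A1 A2 A3 Nb)
    (hNr : nine_point_center Red A1 A2 A3 Nr)
    (hNg : nine_point_center Green A1 A2 A3 Ng) :
  [/\ Nb = midpoint Cr Cg, Nr = midpoint Cb Cg & Ng = midpoint Cb Cr].
Proof.
have triM := medial_triangle char_neq2 triA.
rewrite (circumcenter_pointP char_neq2 triA hCb)
        (circumcenter_pointP char_neq2 triA hCr)
        (circumcenter_pointP char_neq2 triA hCg)
        (circumcenter_pointP char_neq2 triM hNb)
        (circumcenter_pointP char_neq2 triM hNr)
        (circumcenter_pointP char_neq2 triM hNg).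
rewrite /circumcenter_point (tri_det_medial char_neq2).
have D0 : tri_det A1 A2 A3 != 0 := noncollinear_det triA.
have two0 : 2 != 0 :> F by move: char_neq2; rewrite inE.
have four0 : 4 != 0 :> F by rewrite (natrM F 2 2) mulf_neq0.
(* The identity concerns the numerators alone, so it holds with the determinant replaced by any
   nonzero [d]. *)
move: (tri_det A1 A2 A3) D0 => d d0; rewrite /midpoint /=.
by split; congr pair; field; rewrite ?two0 ?four0 ?d0.
Qed.
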